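(* Let $c,\beta,\sigma_h^2,d,P_{\mathrm{erp}}>0$ and $\alpha\ge2$ be fixed. Let $N$ user equipments, all at distance $d$ from the power beacon, have independent instantaneous output DC powers $P_{\mathrm{out}-i}=c\beta d^{-\alpha}|h_i|^2$, $i=1,\dots,N$, where each $|h_i|^2$ is exponentially distributed with mean $\sigma_h^2$. Then opportunistic scheduling yields a scheduling gain of $\ln N$ in terms of power transfer efficiency compared with round-robin scheduling, i.e. as $N\to\infty$, $$\frac{\overline{P_{\mathrm{os}}^{\mathrm{hom}}}/P_{\mathrm{erp}}}{\overline{P_{\mathrm{rrs}}^{\mathrm{hom}}}/P_{\mathrm{erp}}}\sim\ln N,$$ where $\overline{P_{\mathrm{os}}^{\mathrm{hom}}}=\mathbb{E}\left[\max_{1\le i\le N}P_{\mathrm{out}-i}\right]$ and $\overline{P_{\mathrm{rrs}}^{\mathrm{hom}}}=\mathbb{E}[P_{\mathrm{out}-1}]$.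
   Context: Model: a power beacon with effective radiated power $P_{\mathrm{erp}}$ transmits power wirelessly to users; $c>0$ is a constant depending on the rectifier parameters and proportional to $P_{\mathrm{erp}}$, $\beta>0$ a constant scaling factor, $\alpha$ the path-loss exponent, and $|h_i|^2$ the Rayleigh fading gain. Under round-robin scheduling users are served in periodic turns, and the average output DC power is the mean output power of a single user. Under opportunistic scheduling the user with the maximum instantaneous output DC power is charged in each slot, and the average output DC power is the mean of that maximum. The power transfer efficiency of a scheduling policy is its average output DC power divided by $P_{\mathrm{erp}}$; the scheduling gain is the ratio of the two efficiencies. Notation: $f(N)\sim g(N)$ means $\lim_{N\to\infty}f(N)/g(N)=1$. *)

(* Defs.v *)
From HB Require Import structures.
From mathcomp Require Import all_boot all_order all_algebra.
From mathcomp Require Import all_classical all_reals all_analysis.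

Set Implicit Arguments.
Unset Strict Implicit.
Unset Printing Implicit Defensive.

Import Order.TTheory GRing.Theory Num.Theory.
Import numFieldNormedType.Exports.

Local Open Scope classical_set_scope.
Local Open Scope ring_scope.

(* Mutual independence of a finite family: the product rule holds for every
   subfamily [J]. *)
Definition mutually_independent (disp : measure_display)
    (T : measurableType disp) (R : realType) (P : probability T R)
    (I : finType) (X : I -> T -> R) : Prop :=
  forall (J : {set I}) (B : I -> set R),
    (forall i, i \in J -> measurable (B i)) ->
    P (\bigcap_(i in [set` J]) (X i @^-1` B i)) =
    (\prod_(i in J) P (X i @^-1` B i))%E.

(* [exponential_prob] is parametrised by the rate, the inverse of the mean. *)
Definition exponential_with_mean (disp : measure_display)
    (T : measurableType disp) (R : realType) (P : probability T R)
    (m : R) (X : {RV P >-> R}) : Prop :=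
  forall A : set R, measurable A -> distribution P X A = exponential_prob m^-1 A.

(* [gain] stands for the fading power gain |h_i|^2 of one user. *)
Definition dc_power (R : realType) (T : Type) (c beta d alpha : R)
    (gain : T -> R) : T -> R :=
  fun w => c * beta * d `^ (- alpha) * gain w.

(* The families below are indexed by ['I_n.+1], so there are [n.+1 >= 1] users;
   the first user is [ord0], which also serves as a neutral seed for the
   pointwise maximum. *)
Definition max_power (R : realType) (T : Type) (n : nat)
    (X : 'I_n.+1 -> T -> R) : T -> R :=
  fun w => \big[Num.max/X ord0 w]_(i < n.+1) X i w.

(* [fine] maps an infinite expectation to 0. *)
Definition avg_power_os (disp : measure_display) (T : measurableType disp)
    (R : realType) (P : probability T R) (n : nat)
    (X : 'I_n.+1 -> T -> R) : R :=
  fine ('E_P[max_power X])%E.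

Definition avg_power_rrs (disp : measure_display) (T : measurableType disp)
    (R : realType) (P : probability T R) (n : nat)
    (X : 'I_n.+1 -> T -> R) : R :=
  fine ('E_P[X ord0])%E.

Definition efficiency (R : realType) (Perp avg : R) : R := avg / Perp.

Definition scheduling_gain (disp : measure_display) (T : measurableType disp)
    (R : realType) (P : probability T R) (Perp : R) (n : nat)
    (X : 'I_n.+1 -> T -> R) : R :=
  efficiency Perp (avg_power_os P X) / efficiency Perp (avg_power_rrs P X).

Definition asymp_equiv (R : realType) (f g : nat -> R) : Prop :=
  (fun n => f n / g n) @ \oo --> (1 : R).

(* Main.v *)
(* The maximum of N independent exponentials of mean m has distribution function
   (1 - e^(-t/m))^N, so its expectation is the integral over [0, +oo[ of
   1 - (1 - e^(-t/m))^N = sum_(k < N) e^(-t/m) (1 - e^(-t/m))^k, whose terms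
   integrate to m / (k + 1). The scheduling gain is therefore exactly the
   harmonic number H_N, and H_N ~ ln N. *)
Require Import Defs.
From HB Require Import structures.
From mathcomp Require Import all_boot all_order all_algebra.
From mathcomp Require Import all_classical all_reals all_analysis.
From mathcomp Require Import measurable_realfun ring.
Import Order.TTheory GRing.Theory Num.Theory.
Import numFieldNormedType.Exports.
Local Open Scope classical_set_scope.
Local Open Scope ring_scope.

(** * Integral of the tail of the maximum *)

Lemma is_derive_exp_cdf (R : realType) (m t : R) :
  is_derive t 1 (fun s => 1 - expR (- s / m)) (m^-1 * expR (- t / m)).
Proof.
apply: is_derive_eq; rewrite /GRing.scale/=; ring.
Qed.

(** With [u = 1 - expR (- t / m)], the geometric sum writes [1 - u ^+ n] as the sum of
    [(1 - u) * u ^+ k] over [k < n]. Since [u' = (1 - u) / m], each term is the derivative of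
    [m * u ^+ k.+1 / k.+1]; the induction adds one term at a time. *)
Lemma is_derive_exp_max_primitive (R : realType) (m : R) (n : nat) (t : R) :
  m != 0 ->
  is_derive t 1
    (fun s => \sum_(k < n) m * (k.+1%:R^-1 * (1 - expR (- s / m)) ^+ k.+1))
    (1 - (1 - expR (- t / m)) ^+ n).
Proof.
move=> m0; elim: n => [|n IH].
  rewrite expr0 subrr.
  have -> : (fun s : R => \sum_(k < 0) m * (k.+1%:R^-1 *
      (1 - expR (- s / m)) ^+ k.+1)) = cst 0.
    by apply/funext => s; rewrite big_ord0.
  exact: is_derive_cst.
have -> : (fun s : R => \sum_(k < n.+1) m * (k.+1%:R^-1 *
      (1 - expR (- s / m)) ^+ k.+1)) =
  (fun s : R => \sum_(k < n) m * (k.+1%:R^-1 *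
      (1 - expR (- s / m)) ^+ k.+1)) +
  (m * n.+1%:R^-1) \*: (fun s => 1 - expR (- s / m)) ^+ n.+1.
  apply/funext => s; rewrite big_ord_recr/= !fctE mulrA; congr (_ + _ * _).
have D := @is_derive_exp_cdf R m t.
apply: (is_derive_eq (is_deriveD IH
  (is_deriveZ (m * n.+1%:R^-1) (is_deriveX n.+1 D)))).
rewrite /GRing.scale/= exprS.
have n0 : n.+1%:R != 0 :> R by rewrite pnatr_eq0.
move: n.+1%:R n0 => N n0; field; exact/andP.
Qed.

(** The primitive above vanishes at 0, where [u = 0]. At infinity [u] tends to 1, so the k-th term
    tends to [m / k.+1]. *)
Lemma integral_exp_max_tail (R : realType) (m : R) (n : nat) : 0 < m ->
  (\int[lebesgue_measure]_(t in `[0%R, +oo[)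
     (1 - (1 - expR (- t / m)) ^+ n)%:E)%E = (m * series (@harmonic R) n)%:E.
Proof.
move=> m0; have mn0 : m != 0 by rewrite gt_eqF.
have D t := @is_derive_exp_max_primitive R m n t mn0.
have C1 : continuous (fun s : R => 1 - expR (- s / m)).
  move=> t; apply: differentiable_continuous; apply/derivable1_diffP.
  by have [] := is_derive_exp_cdf R m t.
rewrite (@ge0_continuous_FTC2y _ _
   (fun s => \sum_(k < n) m * (k.+1%:R^-1 * (1 - expR (- s / m)) ^+ k.+1))
   0 (m * series (@harmonic R) n)).
- rewrite big1 ?sube0// => k _.
  by rewrite oppr0 mul0r expR0 subrr expr0n !mulr0.
- move=> t t0; rewrite subr_ge0 exprn_ile1//.
  by rewrite subr_ge0 -[leRHS]expR0 ler_expR mulNr oppr_le0 divr_ge0// ltW.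
- apply: continuous_subspaceT => t.
  apply: cvgB; first exact: cvg_cst.
  apply: (@continuous_cvg _ _ _ _ _ (fun s : R => 1 - expR (- s / m))
    (fun x : R => x ^+ n)); [exact: exprn_continuous|exact: C1].
- rewrite seriesEord mulr_sumr; apply: cvg_big => [|k _]; first exact: add_continuous.
  apply: cvgMr; rewrite -[X in _ --> X]mulr1; apply: cvgMr.
  rewrite -[X in _ --> X](expr1n _ k.+1).
  apply: (@continuous_cvg _ _ _ _ _ (fun s : R => 1 - expR (- s / m))
    (fun x : R => x ^+ k.+1)); first exact: exprn_continuous.
  rewrite -[X in _ --> X]subr0; apply: cvgB; first exact: cvg_cst.
  rewrite (_ : (fun s => expR (- s / m)) =
               (fun z => expR (- z)) \o (fun z => m^-1 * z)); last first.
    by apply: funext => x /=; rewrite mulNr mulrC.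
  apply: (@cvg_comp _ _ _ _ _ _ (pinfty_nbhs R)); last exact: cvgr_expR.
  by apply: gt0_cvgMry => //; rewrite invr_gt0.
- by move=> t _; have [] := D t.
- apply: cvg_at_right_filter.
  apply: differentiable_continuous; apply/derivable1_diffP.
  by have [] := D 0.
- by move=> t _; rewrite derive1E; have [_ ->] := D t.
Qed.

(** * Harmonic numbers against the logarithm *)

(** By induction: the increment [ln (1 + 1 / n.+1)] is at most [1 / n.+1], from
    [ln (1 + x) <= x]. *)
Lemma ln_le_series_harmonic (R : realType) (n : nat) :
  ln (n.+1%:R : R) <= series (@harmonic R) n.
Proof.
elim: n => [|n IH]; first by rewrite ln1 seriesEord/= big_ord0.
have n0 : 0 < n.+1%:R :> R by rewrite ltr0n.
rewrite seriesSr/=.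
have -> : n.+2%:R = n.+1%:R * (1 + n.+1%:R^-1) :> R.
  by rewrite mulrDr mulr1 divff ?gt_eqF// -natr1.
have v0 : 0 < n.+1%:R^-1 :> R by rewrite invr_gt0.
rewrite lnM ?posrE ?addr_gt0// lerD//.
by apply: le_ln1Dx; rewrite (lt_trans _ v0)// ltrN10.
Qed.

(** The same inequality at [x = - 1 / n.+2] bounds the logarithmic increment [- ln (1 - 1 / n.+2)]
    below by [1 / n.+2]. *)
Lemma series_harmonic_le_1Dln (R : realType) (n : nat) :
  series (@harmonic R) n.+1 <= 1 + ln (n.+1%:R : R).
Proof.
elim: n => [|n IH]; first by rewrite ln1 addr0 seriesEord/= big_ord1 invr1.
rewrite seriesSr/=.
rewrite (le_trans (lerD IH (lexx _)))// -addrA lerD2l -lerBrDl.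
have n1 : 0 < n.+1%:R :> R by rewrite ltr0n.
have n2 : 0 < n.+2%:R :> R by rewrite ltr0n.
rewrite -ln_div ?posrE// -lerN2 -lnV ?posrE ?divr_gt0// invf_div.
have -> : n.+1%:R / n.+2%:R = 1 + - n.+2%:R^-1 :> R.
  by rewrite -[n.+2%:R]natr1 in n2 *; field; rewrite gt_eqF.
by apply: le_ln1Dx; rewrite ltrN2 invf_lt1// ltr1n.
Qed.

Lemma cvg_ln_natS (R : realType) : (fun n => ln (n.+1%:R : R)) @ \oo --> +oo.
Proof.
apply/cvgryPge => A; near=> n.
rewrite -[leLHS]expRK ler_ln ?posrE ?expR_gt0 ?ltr0n//.
rewrite (le_trans (_ : _ <= n%:R)) ?ler_nat//.
by near: n; exact: nbhs_infty_ger.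
Unshelve. all: by end_near. Qed.

(** The two bounds squeeze the quotient between 1 and [1 + 1 / ln n.+1]. *)
Lemma cvg_harmonic_div_ln (R : realType) :
  asymp_equiv (fun n => series (@harmonic R) n.+1) (fun n => ln (n.+1%:R : R)).
Proof.
(* The logarithm is 0 at [n = 0], so positivity starts at [n = 1]. *)
have ln_gt0_near : \forall n \near \oo, 0 < ln (n.+1%:R : R).
  by near=> n; apply: ln_gt0; rewrite ltr1n ltnS; near: n; exists 1%N.
apply: (@squeeze_cvgr _ _ _ _ (cst 1) (fun n => (ln (n.+1%:R : R))^-1 + 1)).
- near=> n.
  have l0 : 0 < ln (n.+1%:R : R) by near: n.
  apply/andP; split.
    rewrite ler_pdivlMr// mul1r (le_trans (ln_le_series_harmonic R n))//.
    by rewrite seriesSr/= lerDl.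
  rewrite ler_pdivrMr// mulrDl mulVf ?gt_eqF// mul1r.
  exact: series_harmonic_le_1Dln.
- exact: cvg_cst.
- rewrite -[X in _ --> X]add0r; apply: cvgD; last exact: cvg_cst.
  by apply/gtr0_cvgV0 => //; exact: cvg_ln_natS.
Unshelve. all: by end_near. Qed.

(** * Distribution and mean of the maximum *)

Section max_of_exponentials.
Context (disp : measure_display) (T : measurableType disp) (R : realType)
  (P : probability T R).

Lemma exponential_with_mean_cdf (m : R) (X : {RV P >-> R}) (t : R) :
  0 < m -> exponential_with_mean m X -> 0 <= t ->
  P (X @^-1` `]-oo, t]) = (1 - expR (- t / m))%:E.
Proof.
move=> m0 /(_ `]-oo, t]%classic (measurable_itv _)).
rewrite /distribution /pushforward => -> t0.
(* The density vanishes on the negative reals, so only the part of [D] in [[0, +oo[] carries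
   mass. *)
have restr (D : set R) : exponential_prob m^-1 D =
    exponential_prob m^-1 (D `&` `[0, +oo[%classic).
  rewrite /exponential_prob integral_mkcondr; apply: eq_integral => x _.
  by rewrite /exponential_pdf !patchE; case: ifP.
rewrite restr.
have -> : `]-oo, t]%classic `&` `[0, +oo[%classic = `[0, t]%classic :> set R.
  by apply/seteqP; split => x /=; rewrite !in_itv/= andbT; rewrite andbC => /andP.
have [<-|] := eqVneq 0 t.
  by rewrite set_itv1 /exponential_prob integral_set1 oppr0 mul0r expR0 subrr.
rewrite eq_sym => tn0.
rewrite exponential_prob_itv0c ?lt_def ?tn0// EFinB.
by congr (_ - (expR _)%:E)%E; rewrite mulrC mulrN mulNr.
Qed.

Lemma measurable_max_power (n : nat) (X : 'I_n.+1 -> T -> R) :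
  (forall i, measurable_fun setT (X i)) -> measurable_fun setT (max_power X).
Proof.
move=> mX; rewrite /max_power.
elim: (index_enum _) => [|i s IH].
  by under eq_fun do rewrite big_nil; exact: mX.
under eq_fun do rewrite big_cons.
exact: measurable_maxr.
Qed.

Lemma max_power_preimage (n : nat) (X : 'I_n.+1 -> T -> R) (t : R) :
  max_power X @^-1` `]-oo, t] =
  \bigcap_(i in [set` [set: 'I_n.+1]%SET]) (X i @^-1` `]-oo, t]).
Proof.
apply/seteqP; split => w /=.
  rewrite in_itv/= => /bigmax_leP[_ H] i _/=.
  by rewrite in_itv/= H.
(* The seed [X ord0] must be bounded too; it is a member of the family. *)
move=> H; rewrite in_itv/=; apply/bigmax_leP.
have {}H i : X i w <= t by have := H i; rewrite /= inE in_itv/=; exact.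
by [].
Qed.

Lemma max_power_cdf (n : nat) (X : 'I_n.+1 -> T -> R) (m t : R) :
  mutually_independent P X ->
  (forall i, P (X i @^-1` `]-oo, t]) = (1 - expR (- t / m))%:E) ->
  P (max_power X @^-1` `]-oo, t]) = ((1 - expR (- t / m)) ^+ n.+1)%:E.
Proof.
move=> iX cX; rewrite max_power_preimage iX//.
rewrite (eq_bigr (fun=> (1 - expR (- t / m))%:E)) => [|i _]; last exact: cX.
rewrite prodEFin.
by rewrite prodr_const cardsT card_ord.
Qed.

(** Only the distribution function of [Y] enters, so the result serves both the maximum over all
    users and, with [n = 0], a single user. *)
Lemma expectation_exp_max (Y : T -> R) (m : R) (n : nat) :
  0 < m -> measurable_fun setT Y ->
  (forall t, 0 <= t ->
    P (Y @^-1` `]-oo, t]) = ((1 - expR (- t / m)) ^+ n.+1)%:E) ->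
  ('E_P[Y] = (m * series (@harmonic R) n.+1)%:E)%E.
Proof.
move=> m0 mY cY; rewrite -integral_exp_max_tail//.
(* [Y] is nonnegative only almost surely, so the tail formula is applied to its
   positive part. *)
pose Z0 : T -> R := fun w => Num.max 0 (Y w).
have mZ : measurable_fun setT Z0 by exact: measurable_maxr.
pose Z : {RV P >-> R} := HB.pack Z0 (isMeasurableFun.Build _ _ _ _ Z0 mZ).
have -> : ('E_P[Y] = 'E_P[Z])%E.
  rewrite unlock; apply: ae_eq_integral => //.
  - exact/measurable_EFinP.
  - exact/measurable_EFinP.
  (* [Y] and its positive part can differ only where [Y <= 0], an event of probability
     [0 ^+ n.+1 = 0]. *)
  exists (Y @^-1` `]-oo, 0%R]); split.
  - by rewrite -[X in measurable X]setTI; exact: mY.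
  - by apply: (etrans (cY 0 (lexx 0))); rewrite oppr0 mul0r expR0 subrr expr0n.
  - move=> w /= H; rewrite in_itv/= leNgt; apply/negP => Y0; apply: H => _.
    by rewrite /Z0 max_r// ltW.
rewrite ge0_expectation_ccdf => [|w]; last by rewrite /= /Z0 le_max lexx.
apply: eq_integral => t; rewrite inE/= in_itv/= andbT => t0.
rewrite ccdf_1_cdf EFinB; congr (_ - _)%E.
(* For [t >= 0], the maximum of 0 and [Y] is at most [t] exactly when [Y] is. *)
rewrite -cY// /cdf /distribution /pushforward; congr (P _).
apply/seteqP; split => w /=; rewrite !in_itv/= /Z0 ge_max; first by case/andP.
by rewrite t0.
Qed.

End max_of_exponentials.

(** * The scheduling gain *)

(** Scaling by a positive constant keeps the law exponential and scales its mean. *)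
Lemma dc_power_cdf (disp : measure_display) (T : measurableType disp)
  (R : realType) (P : probability T R) (c beta d alpha m t : R)
  (gain : {RV P >-> R}) :
  0 < c -> 0 < beta -> 0 < d -> 0 < m -> exponential_with_mean m gain ->
  0 <= t ->
  P (dc_power c beta d alpha gain @^-1` `]-oo, t]) =
  (1 - expR (- t / (c * beta * d `^ (- alpha) * m)))%:E.
Proof.
move=> c0 b0 d0 m0 gm t0.
have K0 : 0 < c * beta * d `^ (- alpha) by rewrite !mulr_gt0// powR_gt0.
rewrite /dc_power; move: (c * beta * d `^ (- alpha)) K0 => K K0.
have -> : (fun w => K * gain w) @^-1` `]-oo, t] = gain @^-1` `]-oo, t / K].
  by apply/seteqP; split => w /=; rewrite !in_itv/= ler_pdivlMr// mulrC.
rewrite (@exponential_with_mean_cdf _ _ _ _ m _ _ m0 gm) ?divr_ge0 ?(ltW K0)//.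
by congr (1 - expR _)%:E; field; rewrite !gt_eqF.
Qed.

Lemma scheduling_gainE (disp : measure_display) (T : measurableType disp)
  (R : realType) (P : probability T R) (c beta d alpha Perp m : R) (n : nat)
  (gain : 'I_n.+1 -> {RV P >-> R}) :
  0 < c -> 0 < beta -> 0 < d -> 0 < Perp -> 0 < m ->
  (forall i, exponential_with_mean m (gain i)) ->
  mutually_independent P (fun i => dc_power c beta d alpha (gain i)) ->
  scheduling_gain P Perp (fun i => dc_power c beta d alpha (gain i)) =
  series (@harmonic R) n.+1.
Proof.
move=> c0 b0 d0 p0 m0 gm ind.
pose M := c * beta * d `^ (- alpha) * m.
have M0 : 0 < M by rewrite !mulr_gt0// powR_gt0.
have mX i : measurable_fun setT (dc_power c beta d alpha (gain i)).
  exact: measurable_funM.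
have cX i t : 0 <= t -> _ :=
  @dc_power_cdf _ _ _ P _ _ _ alpha _ t _ c0 b0 d0 m0 (gm i).
rewrite /scheduling_gain /avg_power_os /avg_power_rrs.
rewrite (@expectation_exp_max _ _ _ _ _ M n)//; last 2 first.
- exact: measurable_max_power.
- by move=> t t0; apply: max_power_cdf => // i; exact: cX.
(* One user is a maximum of one variable: its mean is [M] times the first harmonic number, 1, and
   [M] cancels in the ratio. *)
rewrite (@expectation_exp_max _ _ _ _ _ M 0)//; last first.
  by move=> t t0; rewrite expr1; exact: cX.
rewrite /= /efficiency.
have -> : series (@harmonic R) 1 = 1 by rewrite seriesEord/= big_ord1 invr1.
rewrite mulr1.
by field; rewrite !gt_eqF.
Qed.

Theorem corollary1 (R : realType) (c beta sigma_h2 d Perp alpha : R)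
  (c_gt0 : 0 < c) (beta_gt0 : 0 < beta) (sigma_h2_gt0 : 0 < sigma_h2)
  (d_gt0 : 0 < d) (Perp_gt0 : 0 < Perp) (alpha_ge2 : 2 <= alpha)
  (disp : nat -> measure_display)
  (T : forall n : nat, measurableType (disp n))
  (P : forall n : nat, probability (T n) R)
  (gain : forall n : nat, 'I_n.+1 -> {RV (P n) >-> R})
  (gain_exp : forall (n : nat) (i : 'I_n.+1),
     exponential_with_mean sigma_h2 (gain n i))
  (power_indep : forall n : nat,
     mutually_independent (P n)
       (fun i : 'I_n.+1 => dc_power c beta d alpha (gain n i))) :
  asymp_equiv
    (fun n : nat => scheduling_gain (P n) Perp
       (fun i : 'I_n.+1 => dc_power c beta d alpha (gain n i)))
    (fun n : nat => ln (n.+1%:R : R)).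
Proof.
(* The gain is computed for each [n] separately, so the probability space may change with [n]. *)
have -> : (fun n : nat => scheduling_gain (P n) Perp
       (fun i : 'I_n.+1 => dc_power c beta d alpha (gain n i))) =
    (fun n => series (@harmonic R) n.+1).
  by apply/funext => n; exact: (@scheduling_gainE _ _ _ _ _ _ _ _ _ sigma_h2).
exact: cvg_harmonic_div_ln.
Qed.
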